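(* Let $n\ge 1$ and $k\ge 0$ be integers. Of all graphs on $n$ vertices, the Turán graph $\mathcal{T}_{n,k+1}$ maximizes the $k$-th Betti number of the flag complex, i.e. \[\max_{G\in \mathbf{G}(n)} \beta_k(X(G)) = \beta_k(X(\mathcal{T}_{n,k+1})),\] where $\mathbf{G}(n)$ is the set of graphs on $n$ vertices. In particular, if $n$ is a multiple of $k+1$, then \[\max_{G\in \mathbf{G}(n)} \beta_k(X(G)) = \Bigl(\frac{n}{k+1}-1\Bigr)^{k+1}.\]
   Context: Graphs are finite and simple. For a graph $G$, $X(G)$ denotes the flag complex of $G$: the simplicial complex on $V(G)$ whose $m$-simplices are the $(m+1)$-cliques of $G$. $\beta_k(K)$ denotes the dimension of the reduced simplicial homology $\tilde H_k(K;\mathbf{k})$ with coefficients in a fixed but arbitrary field $\mathbf{k}$. For $n\ge0$ and $k\ge1$, the Turán graph $\mathcal{T}_{n,k}$ is the complement of the graph $\bigsqcup_{i=1}^k K_{n_i}$, where, with $n'$ the smallest positive integer such that $n'\equiv n \bmod k$, $n_i=\lceil n/k\rceil$ for $1\le i\le n'$ and $n_i=\lfloor n/k\rfloor$ for $n'<i\le k$; that is, it is the complete $k$-partite graph on $n$ vertices with parts as equal as possible. *)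

(* Defs.v *)
From HB Require Import structures.
From mathcomp Require Import all_boot all_order all_algebra.

Set Implicit Arguments.
Unset Strict Implicit.
Unset Printing Implicit Defensive.

Import GRing.Theory.
Local Open Scope ring_scope.

(** Finite simple graphs on the vertex set ['I_n], given by their edge sets. *)

Definition sgraph (n : nat) :=
  {E : {set {set 'I_n}} | [forall e in E, #|e| == 2%N]}.

HB.instance Definition _ n := SubFinite.on (sgraph n).

Definition adj n (G : sgraph n) (u v : 'I_n) : bool := [set u; v] \in val G.

Fact edges_subproof n (P : pred {set 'I_n}) :
  [forall e in [set e : {set 'I_n} | (#|e| == 2%N) && P e], #|e| == 2%N].
Proof. by apply/forall_inP => e; rewrite inE => /andP[]. Qed.

Definition graph_of_edges n (P : pred {set 'I_n}) : sgraph n :=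
  exist (fun E : {set {set 'I_n}} => [forall e in E, #|e| == 2%N]) _
    (edges_subproof P).

Definition compl_graph n (G : sgraph n) : sgraph n :=
  graph_of_edges [pred e | e \notin val G].

(** The disjoint union of the complete graphs of orders [sh_0, sh_1, ...], with
    the vertex sets of the components being consecutive intervals of
    [{0, ..., n - 1}]; it is only meaningful when [sumn sh = n]. *)
Definition disjoint_cliques n (sh : seq nat) : sgraph n :=
  graph_of_edges
    [pred e : {set 'I_n} | [forall u in e, forall v in e,
       reshape_index sh u == reshape_index sh v]].

(** The smallest positive integer congruent to [n] modulo [k], for [k > 0]
    (see [turan_remP]). *)
Definition turan_rem (n k : nat) : nat := (if k %| n then k else n %% k)%N.

Definition ceil_div (n k : nat) : nat := ((n + k.-1) %/ k)%N.

Definition turan_sizes (n k : nat) : seq nat :=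
  [seq (if (i <= turan_rem n k)%N then ceil_div n k else (n %/ k)%N)
     | i <- iota 1 k].

Definition turan (n k : nat) : sgraph n :=
  compl_graph (disjoint_cliques n (turan_sizes n k)).

(** The set of all cliques.  The empty clique is included: it is the
    [(-1)]-simplex of the augmented chain complex computing reduced homology. *)
Definition flag_complex n (G : sgraph n) : {set {set 'I_n}} :=
  [set s : {set 'I_n} |
     [forall u in s, forall v in s, (u != v) ==> adj G u v]].

(** Reduced simplicial homology.  All chains live in the space freely spanned
    by the subsets of ['I_n], a set [{v_0 < ... < v_m}] standing for the oriented
    simplex [[v_0, ..., v_m]]. *)

Section Homology.

Variables (F : fieldType) (n : nat).

Notation chain := {ffun {set 'I_n} -> F^o}.

Definition simplex (s : {set 'I_n}) : chain := [ffun t => (t == s)%:R].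

Definition position (v : 'I_n) (s : {set 'I_n}) : nat :=
  #|[set u in s | (u < v)%N]|.

Definition boundary_simplex (s : {set 'I_n}) : chain :=
  \sum_(v in s) (-1) ^+ position v s *: simplex (s :\ v).

Definition boundary_fun (c : chain) : chain :=
  \sum_(s : {set 'I_n}) (c s : F) *: boundary_simplex s.

Fact boundary_fun_is_linear : linear boundary_fun.
Proof.
move=> a c1 c2; rewrite /boundary_fun scaler_sumr -big_split /=.
by apply: eq_bigr => s _; rewrite !ffunE scalerDl scalerA.
Qed.

HB.instance Definition _ :=
  GRing.isLinear.Build F chain chain _ boundary_fun boundary_fun_is_linear.

Definition boundary : 'End(chain) := linfun boundary_fun.

(** [chains K p] is spanned by the simplices of [K] with [p] vertices, so it is
    the chain group of dimension [p - 1]; the shift accommodates dimension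
    [-1]. *)
Definition chains (K : {set {set 'I_n}}) (p : nat) : {vspace chain} :=
  <<[seq simplex s | s in [set s in K | #|s| == p]]>>%VS.

Definition cycles K (k : nat) : {vspace chain} :=
  (chains K k.+1 :&: lker boundary)%VS.

Definition boundaries K (k : nat) : {vspace chain} :=
  (boundary @: chains K k.+2)%VS.

(** The dimension of [cycles K k / boundaries K k]; the subtraction does not
    truncate, see [boundaries_sub_cycles]. *)
Definition betti K (k : nat) : nat := (\dim (cycles K k) - \dim (boundaries K k))%N.

Lemma boundaryE s : boundary (simplex s) = boundary_simplex s.
Proof.
rewrite lfunE /= /boundary_fun (bigD1 s) //= ffunE eqxx scale1r.
rewrite big1 ?addr0 // => t /negbTE nts.
by rewrite ffunE nts scale0r.
Qed.

Lemma boundary_boundary s : boundary (boundary (simplex s)) = 0.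
Proof.
pose g u v : chain := (-1) ^+ (position u s + position v (s :\ u)) *:
  simplex ((s :\ u) :\ v).
have -> : boundary (boundary (simplex s)) =
    \sum_(u in s) \sum_(v in s | v != u) g u v.
  rewrite boundaryE /boundary_simplex linear_sum; apply: eq_bigr => u us.
  rewrite linearZ /= boundaryE /boundary_simplex scaler_sumr.
  apply: eq_big => [v|v _]; first by rewrite !inE andbC.
  by rewrite scalerA -exprD.
have posD (u v : 'I_n) : u \in s ->
    position v s = ((u < v)%N + position v (s :\ u))%N.
  move=> us; rewrite /position (cardsD1 u) !inE us /=; congr (_ + #|pred_of_set _|)%N.
  by apply/setP=> w; rewrite !inE andbA.
have gN (u v : 'I_n) : u \in s -> v \in s -> (u < v)%N -> g u v = - g v u.
  move=> us vs uv; rewrite /g.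
  have -> : s :\ u :\ v = s :\ v :\ u by apply/setP=> w; rewrite !inE andbCA.
  rewrite -scaleNr; congr (_ *: _).
  rewrite (posD u v) // (posD v u) // uv ltnNge (ltnW uv) /= add0n.
  by rewrite add1n addSn exprS mulN1r opprK addnC.
rewrite (eq_bigr (fun u : 'I_n =>
    \sum_(v : 'I_n | (v \in s) && (u < v)%N) g u v +
    \sum_(v : 'I_n | (v \in s) && (v < u)%N) g u v)); last first.
  move=> u us; rewrite (bigID (fun v : 'I_n => (u < v)%N)) /=.
  by congr (_ + _); apply: eq_bigl => v; rewrite -val_eqE /=;
    case: (v \in s); case: ltngtP.
rewrite big_split /= [X in _ + X](exchange_big_dep (mem s)) /=; last first.
  by move=> u v _ /andP[].
rewrite -big_split big1 //= => u us.
rewrite [X in _ + X](eq_bigl (fun v : 'I_n => (v \in s) && (u < v)%N)); last first.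
  by move=> v; rewrite us.
rewrite -big_split big1 //= => v /andP[vs uv].
by rewrite gN // addNr.
Qed.

Lemma boundaries_sub_cycles (K : {set {set 'I_n}}) k :
  (forall s t : {set 'I_n}, s \in K -> t \subset s -> t \in K) ->
  (boundaries K k <= cycles K k)%VS.
Proof.
move=> Kdown; rewrite /boundaries /chains limg_span.
apply/span_subvP => _ /mapP[_ /mapP[s sK ->] ->].
move: sK; rewrite mem_enum inE => /andP[sK /eqP cs].
rewrite memv_cap memv_ker boundary_boundary eqxx andbT boundaryE.
apply: memv_suml => v vs; apply: memvZ; apply: memv_span; apply: map_f.
rewrite mem_enum inE (Kdown _ _ sK) ?subsetDl //=.
by rewrite -eqSS -cs (cardsD1 v s) vs.
Qed.

End Homology.

Lemma flag_complex_down n (G : sgraph n) (s t : {set 'I_n}) :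
  s \in flag_complex G -> t \subset s -> t \in flag_complex G.
Proof.
rewrite !inE => /forall_inP sG /subsetP ts; apply/forall_inP => u /ts us.
by apply/forall_inP => v /ts vs; move/forall_inP: (sG _ us); apply.
Qed.

Lemma turan_remP n k : (0 < k)%N ->
  [/\ (0 < turan_rem n k)%N, turan_rem n k = n %[mod k] &
      forall m, (0 < m)%N -> m = n %[mod k] -> (turan_rem n k <= m)%N].
Proof.
move=> k0; rewrite /turan_rem; case: ifP => [kn|/negbT nkn].
  split=> // [|m m0 mn]; first by rewrite modnn (eqP kn).
  by apply: dvdn_leq; rewrite // /dvdn mn.
split; rewrite ?modn_mod ?lt0n // => m _ <-; exact: leq_mod.
Qed.

Lemma size_turan_sizes n k : size (turan_sizes n k) = k.
Proof. by rewrite size_map size_iota. Qed.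

Lemma sumn_turan_sizes n k : (0 < k)%N -> sumn (turan_sizes n k) = n.
Proof.
move=> k0; have rk : (turan_rem n k <= k)%N.
  by rewrite /turan_rem; case: ifP => // _; apply/ltnW/ltn_pmod.
have mc (c : nat) (s : seq nat) : nseq (size s) c = [seq c | _ <- s].
  by elim: s => //= _ s ->.
have -> : turan_sizes n k =
    [seq if (i <= turan_rem n k)%N then ceil_div n k else (n %/ k)%N
       | i <- iota 1 (turan_rem n k) ++
              iota (1 + turan_rem n k) (k - turan_rem n k)].
  by rewrite -iotaD subnKC.
rewrite map_cat sumn_cat.
have -> : [seq if (i <= turan_rem n k)%N then ceil_div n k else (n %/ k)%N
             | i <- iota 1 (turan_rem n k)]
          = nseq (turan_rem n k) (ceil_div n k).
  rewrite -[in RHS](size_iota 1 (turan_rem n k)) mc; apply/eq_in_map.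
  by move=> i; rewrite mem_iota add1n ltnS => /andP[_ ->].
have -> : [seq if (i <= turan_rem n k)%N then ceil_div n k else (n %/ k)%N
             | i <- iota (1 + turan_rem n k) (k - turan_rem n k)]
          = nseq (k - turan_rem n k) (n %/ k)%N.
  rewrite -[in RHS](size_iota (1 + turan_rem n k) (k - turan_rem n k)) mc.
  apply/eq_in_map => i; rewrite mem_iota add1n => /andP[ri _].
  by rewrite leqNgt ri.
have -> : ceil_div n k = (n %/ k + (n %% k + k.-1) %/ k)%N.
  by rewrite /ceil_div {1}(divn_eq n k) -addnA divnMDl.
rewrite !sumn_nseq /turan_rem; case: ifP => [kn|/negbT nkn].
  rewrite subnn muln0 addn0 (eqP kn) add0n [X in (_ + X)%N]divn_small ?prednK //.
  by rewrite addn0 divnK.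
have r0 : (0 < n %% k)%N by rewrite lt0n.
have -> : ((n %% k + k.-1) %/ k = 1)%N.
  rewrite -(prednK r0) addSnnS prednK // divnDr // divnn k0 divn_small //.
  by apply: leq_ltn_trans (leq_pred _) (ltn_pmod _ _).
rewrite mulnDl mul1n addnAC -mulnDr subnKC; last exact/ltnW/ltn_pmod.
by rewrite -divn_eq.
Qed.

(* Main.v *)
Require Import Defs.
From HB Require Import structures.
From mathcomp Require Import all_boot all_order all_algebra.
From mathcomp Require Import zify ring.

Set Implicit Arguments.
Unset Strict Implicit.
Unset Printing Implicit Defensive.

Import GRing.Theory.

(** Let [p] be the number of vertices of the simplices that carry the homology,
    so that [p = k + 1] for the [k]-th Betti number, and call a non-neighbour of
    [v] a vertex other than [v] that is not adjacent to [v].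

    Upper bound.  Removing a vertex [w] from a complex costs at most the Betti
    number of its link, one dimension lower ([reduced_betti_del_link]).  In a
    flag complex the link of [w] is the flag complex of the neighbours of [w].
    Choose [v] with the least number [d] of non-neighbours and remove these one
    after the other: what remains is a cone with apex [v], which is acyclic
    ([reduced_betti_cone]).  Each removed vertex has at most [n - d - 1]
    neighbours, as [d] is least, so the Betti number is at most [d] times the
    largest Betti number, one dimension lower, of a graph on at most [n - d - 1]
    vertices.  Iterating, it is at most a product [d_1 * ... * d_p] of natural
    numbers with sum at most [n - p].  Such a product is largest when the
    factors are as equal as possible ([prod_le_balanced]), which is the value
    [balanced (n - p) p].

    Lower bound.  A complete [p]-partite graph has no clique on [p + 1]
    vertices, so its top homology consists of cycles only.  Fix a vertex [b_i] in
    every part; every choice of a vertex [x_i <> b_i] in every part spans with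
    the [b_i] the boundary of a cross-polytope, which is a cycle.  The simplex
    [{x_1, ..., x_p}] lies on this cross-polytope and on no other one, whence
    these cycles are independent, and their number is the product of the part
    sizes minus one ([reduced_betti_multipartite]).  For the parts of the Turan
    graph this product is again [balanced (n - p) p] ([prod_turan_sizes]).

    The sign computations are confined to the operators [del v] and [ext v] of
    interior and exterior multiplication by a vertex.  They satisfy the Clifford
    relations, and the boundary is the sum of all [del v]. *)

(** * Interior and exterior multiplication by a vertex *)

Section Operators.

Local Open Scope ring_scope.

Variables (F : fieldType) (n : nat).

Notation chain := {ffun {set 'I_n} -> F^o}.

(** The incidence sign of the face [t :\ v] in [t], with values in [F]. *)
Definition sgn (v : 'I_n) (t : {set 'I_n}) : F := (-1) ^+ position v t.

Lemma sgnK v (t : {set 'I_n}) (x : F) : sgn v t * (sgn v t * x) = x.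
Proof. by rewrite mulrA -expr2 sqrr_sign mul1r. Qed.

Lemma sgnU1 v w (t : {set 'I_n}) : w \notin t ->
  sgn v (w |: t) = (-1) ^+ (w < v)%N * sgn v t.
Proof.
move=> wt; rewrite /sgn -exprD; congr (_ ^+ _).
rewrite /position (cardsD1 w) !inE eqxx /=; congr (_ + #|pred_of_set _|)%N.
apply/setP=> u; rewrite !inE; case: (eqVneq u w) => [->|] //=.
by rewrite (negbTE wt).
Qed.

Lemma sgnU1_id v (t : {set 'I_n}) : v \notin t -> sgn v (v |: t) = sgn v t.
Proof. by move=> vt; rewrite sgnU1 // ltnn mul1r. Qed.

Lemma sgnU1_swap v w (t : {set 'I_n}) : w != v -> w \notin t -> v \notin t ->
  sgn w t * sgn v (w |: t) = - (sgn v t * sgn w (v |: t)).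
Proof.
move=> wv wt vt; rewrite !sgnU1 //.
have -> : (-1) ^+ (v < w)%N = - (-1) ^+ (w < v)%N :> F.
  by case: ltngtP wv => [||/val_inj->] //=; rewrite ?eqxx // expr0 expr1 ?opprK.
by rewrite mulNr mulrN opprK mulrCA [RHS]mulrCA (mulrC (sgn w t)).
Qed.

Definition del_fun v (c : chain) : chain :=
  [ffun t : {set 'I_n} => if v \in t then 0 else sgn v t *: c (v |: t)].

Definition ext_fun v (c : chain) : chain :=
  [ffun t : {set 'I_n} => if v \in t then sgn v t *: c (t :\ v) else 0].

Fact del_fun_is_linear v : linear (del_fun v).
Proof.
move=> a c1 c2; apply/ffunP=> t; rewrite !ffunE; case: ifP => _.
  by rewrite scaler0 addr0.
by rewrite scalerDr !scalerA mulrC.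
Qed.

Fact ext_fun_is_linear v : linear (ext_fun v).
Proof.
move=> a c1 c2; apply/ffunP=> t; rewrite !ffunE; case: ifP => _.
  by rewrite scalerDr !scalerA mulrC.
by rewrite scaler0 addr0.
Qed.

HB.instance Definition _ v :=
  GRing.isLinear.Build F chain chain _ (del_fun v) (@del_fun_is_linear v).
HB.instance Definition _ v :=
  GRing.isLinear.Build F chain chain _ (ext_fun v) (@ext_fun_is_linear v).

Definition del v : 'End(chain) := linfun (del_fun v).
Definition ext v : 'End(chain) := linfun (ext_fun v).

Lemma delE v c (t : {set 'I_n}) :
  del v c t = if v \in t then 0 else sgn v t * c (v |: t).
Proof. by rewrite lfunE ffunE. Qed.

Lemma extE v c (t : {set 'I_n}) :
  ext v c t = if v \in t then sgn v t * c (t :\ v) else 0.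
Proof. by rewrite lfunE ffunE. Qed.

(** The coefficient of [t] in the boundary of [c] collects the simplices with
    facet [t], and these are the [v |: t] with [v] outside [t]. *)
Lemma boundary_sum_del c : boundary F n c = \sum_v del v c.
Proof.
apply/ffunP=> t; rewrite lfunE /= /boundary_fun !sum_ffunE.
transitivity (\sum_(s : {set 'I_n}) \sum_v
   (if (v \in s) && (t == s :\ v) then sgn v s * c s else 0)).
  apply: eq_bigr => s _; rewrite ffunE /boundary_simplex sum_ffunE.
  rewrite scaler_sumr big_mkcond; apply: eq_bigr => v _.
  case: (v \in s) => //=; rewrite !ffunE; case: eqP => _.
    by rewrite /GRing.scale /= mulr1 mulrC.
  by rewrite !scaler0.
rewrite exchange_big; apply: eq_bigr => v _; rewrite delE -big_mkcond /=.
case: ifP => vt.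
  rewrite big_pred0 // => s; apply/andP=> -[vs /eqP ts].
  by rewrite ts setD11 in vt.
rewrite (big_pred1 (v |: t)) ?sgnU1_id ?vt // => s.
apply/andP/eqP=> [[vs /eqP->]|->]; first by rewrite setD1K.
by rewrite setU11 setU1K ?vt.
Qed.

(** The lemmas [del_anticomm], [ext_del_anticomm] and [ext_del_id] are the
    Clifford relations.  Between distinct vertices a sign appears because the
    smaller vertex shifts the position of the larger one by one, while the larger
    one has no influence on the position of the smaller one. *)
Lemma del_anticomm v w c : del w (del v c) = - del v (del w c).
Proof.
apply/ffunP=> t; rewrite ffunE !delE !in_setU1.
have [->|wv] := eqVneq w v => /=; first by rewrite mulr0 if_same oppr0.
case: ifPn => wt; first by rewrite mulr0 if_same oppr0.
case: ifPn => vt; first by rewrite mulr0 oppr0.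
by rewrite !mulrA sgnU1_swap // mulNr setUCA.
Qed.

Lemma ext_del_anticomm v w c : w != v -> del v (ext w c) = - ext w (del v c).
Proof.
move=> wv; apply/ffunP=> t; rewrite ffunE !delE !extE delE !inE.
rewrite (negbTE wv) /= [v == w]eq_sym (negbTE wv) /=.
case: (boolP (v \in t)) => vt /=; first by rewrite mulr0 if_same oppr0.
case: (boolP (w \in t)) => wt; last by rewrite mulr0 oppr0.
rewrite -(setD1K wt); set t' := t :\ w.
have wt' : w \notin t' by rewrite setD11.
have vt' : v \notin t' by rewrite !inE negb_and vt orbT.
have wvt' : w \notin v |: t' by rewrite in_setU1 negb_or wv.
rewrite setUCA !setU1K // !sgnU1_id //.
rewrite -[LHS](sgnK w t') -mulrN; congr (_ * _).
rewrite mulrA sgnU1_swap // mulNr; congr (- _).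
by rewrite -mulrA sgnK.
Qed.

Lemma ext_del_id w c : ext w (del w c) + del w (ext w c) = c.
Proof.
apply/ffunP=> t; rewrite ffunE !delE !extE delE !inE eqxx /=.
case: ifPn => wt.
  by rewrite addr0 -(@sgnU1_id w (t :\ w)) ?setD11 // setD1K // sgnK.
by rewrite add0r setU1K // sgnU1_id // sgnK.
Qed.

(** Lets [del w] carry cycles to cycles and boundaries to boundaries. *)
Lemma boundary_del w c : boundary F n (del w c) = - del w (boundary F n c).
Proof.
rewrite !boundary_sum_del linear_sum -sumrN.
by apply: eq_bigr => v _; rewrite del_anticomm.
Qed.

(** The cone formula: [ext w] is a contracting homotopy. *)
Lemma boundary_ext w c : boundary F n (ext w c) = c - ext w (boundary F n c).
Proof.
rewrite !boundary_sum_del linear_sum (bigD1 w) //= [in RHS](bigD1 w) //=.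
rewrite opprD addrA; congr (_ + _).
  by apply/eqP; rewrite eq_sym subr_eq addrC ext_del_id.
by rewrite -sumrN; apply: eq_bigr => v vw; rewrite ext_del_anticomm // eq_sym.
Qed.

Lemma chainsP (K : {set {set 'I_n}}) p (c : chain) :
  reflect (forall s, c s != 0 -> s \in K /\ #|s| = p) (c \in chains F K p).
Proof.
apply: (iffP idP) => [|cK].
  move=> cK s nz; suff /andP[sK /eqP sp] : (s \in K) && (#|s| == p) by [].
  apply: contraR nz => sK; rewrite (coord_span cK) sum_ffunE big1 // => i _.
  rewrite ffunE -(tnth_nth 0); 
  have /mapP[u uK ->] := mem_tnth i
    (image_tuple (@simplex F n) [set s in K | #|s| == p]).
  rewrite ffunE; case: eqP => [su|_]; last by rewrite scaler0.
  by move: uK sK; rewrite mem_enum inE su => ->.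
have -> : c = \sum_(s : {set 'I_n}) (c s : F) *: simplex F s.
  apply/ffunP=> t; rewrite sum_ffunE (bigD1 t) //= !ffunE eqxx.
  rewrite /GRing.scale /= mulr1 big1 ?addr0 // => s st.
  by rewrite !ffunE eq_sym (negbTE st) scaler0.
apply: memv_suml => s _; case: (eqVneq (c s) 0) => [->|/cK[sK sp]].
  by rewrite scale0r mem0v.
by apply/memvZ/memv_span/map_f; rewrite mem_enum inE sK sp eqxx.
Qed.

End Operators.

(** * Cones, links and deletions *)

Section Homology.

Local Open Scope ring_scope.

Variables (F : fieldType) (n : nat).

Notation chain := {ffun {set 'I_n} -> F^o}.
Notation complex := {set {set 'I_n}}.

(** The Betti number in dimension [p - 1].  Indexing by the number of vertices
    gives access to dimension [-1], where the induction on [p] starts. *)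
Definition reduced_betti (K : complex) (p : nat) : nat :=
  (\dim (chains F K p :&: lker (boundary F n))
   - \dim (boundary F n @: chains F K p.+1))%N.

Lemma del_eq0 w (c : chain) :
  (forall s : {set 'I_n}, c s != 0 -> w \notin s) -> del F w c = 0.
Proof.
move=> cw; apply/ffunP=> t; rewrite delE ffunE; case: ifP => // _.
have [->|/cw] := eqVneq (c (w |: t)) 0; first by rewrite mulr0.
by rewrite setU11.
Qed.

Lemma chainsS (K L : complex) p :
  K \subset L -> (chains F K p <= chains F L p)%VS.
Proof.
move=> /subsetP KL; apply/subvP => c /chainsP cK.
by apply/chainsP => s /cK[/KL].
Qed.

Lemma chains_ext w (K : complex) p (c : chain) :
  (forall s : {set 'I_n}, s \in K -> w \notin s -> w |: s \in K) ->
  c \in chains F K p -> ext F w c \in chains F K p.+1.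
Proof.
move=> Kw /chainsP cK; apply/chainsP => s; rewrite extE.
case: ifP => [ws|_]; last by rewrite eqxx.
rewrite mulf_eq0 negb_or => /andP[_ /cK[sK <-]].
by rewrite -(setD1K ws) Kw ?setD11 // setD1K // (cardsD1 w s) ws.
Qed.

Lemma reduced_betti_cone v (K : complex) p :
  (forall s : {set 'I_n}, s \in K -> v |: s \in K) -> reduced_betti K p = 0%N.
Proof.
move=> Kv; apply/eqP; rewrite subn_eq0; apply/dimvS/subvP => c.
rewrite memv_cap memv_ker => /andP[cK /eqP c0].
have -> : c = boundary F n (ext F v c) by rewrite boundary_ext c0 linear0 subr0.
by apply/memv_img/chains_ext => // s /Kv.
Qed.

Lemma reduced_betti_le_card (K : complex) p :
  (reduced_betti K p <= #|[set s : {set 'I_n} in K | #|s| == p]|)%N.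
Proof.
apply: leq_trans (leq_subr _ _) _; apply: leq_trans (dimvS (capvSl _ _)) _.
by apply: leq_trans (dim_span _) _; rewrite size_map -cardE.
Qed.

(** A half of the long exact sequence of the pair formed by [K] and [K] minus
    [w].  The operator [del w] sends a chain to its part around [w], a chain of
    the link; its kernel consists of the chains that avoid [w].  Apply rank and
    nullity to [del w] on the cycles and on the boundaries of [K]. *)
Lemma reduced_betti_del_link w (K : complex) p :
  (reduced_betti K p.+1
     <= reduced_betti [set s : {set 'I_n} in K | w \notin s] p.+1
     + reduced_betti [set s : {set 'I_n} | (w \notin s) && (w |: s \in K)] p)%N.
Proof.
set D := [set s in K | _]; set L := [set s | _].
rewrite /reduced_betti; set dZ := (_ :&: _)%VS; set dB := (_ @: _)%VS.
have ZD : (dZ :&: lker (del F w) <= chains F D p.+1 :&: lker (boundary F n))%VS.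
  apply/subvP => c; rewrite !memv_cap => /andP[/andP[/chainsP cK ->]].
  rewrite memv_ker andbT => /eqP cw; apply/chainsP => s cs.
  have [sK sp] := cK s cs.
  split=> //; rewrite inE sK; apply/negP => ws.
  have := congr1 (fun d : chain => d (s :\ w)) cw.
  rewrite delE setD11 setD1K // ffunE => /eqP.
  by rewrite mulf_eq0 signr_eq0 (negbTE cs).
have ZL : (del F w @: dZ <= chains F L p :&: lker (boundary F n))%VS.
  apply/subvP => _ /memv_imgP[c + ->]; rewrite !memv_cap !memv_ker.
  case/andP=> /chainsP cK /eqP c0.
  rewrite boundary_del c0 linear0 oppr0 eqxx andbT; apply/chainsP => s.
  rewrite delE; case: ifPn => [|ws]; first by rewrite eqxx.
  rewrite mulf_eq0 negb_or => /andP[_ /cK[sK]]; rewrite cardsU1 ws => -[sp].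
  by rewrite inE ws sK.
have BD : (boundary F n @: chains F D p.+2 <= dB :&: lker (del F w))%VS.
  apply/subvP => _ /memv_imgP[c cD ->]; rewrite memv_cap memv_ker.
  have DK : D \subset K by apply/subsetP => s; rewrite inE => /andP[].
  rewrite memv_img ?(subvP (chainsS _ DK)) //=.
  rewrite -[del F w _]opprK -boundary_del del_eq0 ?linear0 ?oppr0 // => s cs.
  by have [] := chainsP _ _ _ cD s cs; rewrite inE => /andP[].
have BL : (boundary F n @: chains F L p.+1 <= del F w @: dB)%VS.
  apply/subvP => _ /memv_imgP[c cL ->].
  have cw : del F w c = 0.
    apply: del_eq0 => s cs.
    by have [] := chainsP _ _ _ cL s cs; rewrite inE => /andP[].
  have cE : c = del F w (ext F w c).
    by rewrite -{1}(ext_del_id w c) cw linear0 add0r.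
  (* A boundary in the link is, up to sign, the trace of a boundary in K. *)
  rewrite cE boundary_del memvN; apply/memv_img/memv_img.
  apply/chainsP => s; rewrite extE; case: ifP => [ws|_]; last by rewrite eqxx.
  rewrite mulf_eq0 negb_or => /andP[_ /(chainsP _ _ _ cL)[]].
  by rewrite inE setD11 setD1K //= (cardsD1 w s) ws => -> ->.
have arith (a b c d : nat) : (a + b - (c + d) <= a - c + (b - d))%N by lia.
apply: leq_trans (arith _ _ _ _); apply: leq_sub.
  by rewrite -(limg_ker_dim (del F w) dZ) leq_add ?dimvS.
by rewrite -(limg_ker_dim (del F w) dB) leq_add ?dimvS.
Qed.

End Homology.

(** * Balanced products *)

Section Product.

Local Open Scope nat_scope.

(** The product of [k > 0] natural numbers with sum [N] that differ by at most
    one. *)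
Definition balanced (N k : nat) : nat :=
  (N %/ k) ^ (k - N %% k) * (N %/ k).+1 ^ (N %% k).

(** For [q > 0] this says that [b <= q * (1 + 1 / q) ^ (b - q)], with an exponent
    that may be negative.  The two sides agree at [q] and at [q + 1], and the
    right one is convex in [b], so it is at least [b] at all other integers.
    Multiplied over the factors of a product, the inequality is sharp exactly
    when all factors are [q] or [q + 1]. *)
Lemma tangent b q : b * q ^ b * q.+1 ^ q <= q ^ q.+1 * q.+1 ^ b.
Proof.
(* The two cases of the Bernoulli inequality: b = q + d and b = q - d. *)
have up d : (q + d) * q ^ d <= q * q.+1 ^ d.
  elim: d => [|d IHd]; first by rewrite addn0.
  rewrite !expnS mulnA [leqRHS]mulnCA.
  apply: leq_trans (leq_mul (leqnn q.+1) IHd).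
  by rewrite mulnA leq_mul //; nia.
have down d : d <= q -> (q - d) * q.+1 ^ d <= q * q ^ d.
  elim: d => [|d IHd] dq; first by rewrite subn0.
  rewrite !expnS mulnA.
  apply: leq_trans (leq_mul (leqnn q) (IHd (ltnW dq))).
  by rewrite mulnA leq_mul //; nia.
have combine x y z t u v : x * y <= z * t -> x * (u * y) * v <= z * u * (v * t).
  move=> H; rewrite [leqLHS](_ : _ = x * y * (u * v)); last by ring.
  rewrite [leqRHS](_ : _ = z * t * (u * v)); last by ring.
  exact: leq_mul.
have [qb|/ltnW bq] := leqP q b.
  have := up (b - q); rewrite -(subnKC qb) addKn; set d := b - q => H.
  by rewrite !expnD expnS combine.
have := down (q - b) (leq_subr _ _); rewrite subKn // => H.
rewrite -[X in _ * q.+1 ^ X <= q ^ X.+1 * _](subnKC bq).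
by rewrite expnS !expnD mulnAC [leqRHS]mulnAC combine.
Qed.

Lemma prod_tangent q (s : seq nat) :
  \prod_(b <- s) b * q ^ sumn s * q.+1 ^ (q * size s)
    <= q ^ (q.+1 * size s) * q.+1 ^ sumn s.
Proof.
elim: s => [|b s IHs]; first by rewrite big_nil !muln0 !expn0.
rewrite big_cons /= !mulnS (expnD q b) 2!(expnD q.+1) (expnD q q.+1).
rewrite [_ * (q ^ b * _)]mulnACA mulnACA [leqRHS]mulnACA.
exact: leq_mul (tangent b q) IHs.
Qed.

Lemma balanced0 N : balanced N 0 = 1.
Proof. by rewrite /balanced exp1n. Qed.

(** [prod_tangent] at the integral part [q] of the average.  If [q = 0], then
    some factor is 0. *)
Lemma prod_le_balanced (s : seq nat) N :
  sumn s <= N -> \prod_(b <- s) b <= balanced N (size s).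
Proof.
move=> sN; have [k0|k0] := posnP (size s).
  by rewrite (size0nil k0) big_nil balanced0.
have [Nk|kN] := ltnP N (size s).
  have s0 : 0 \in s.
    apply: contraTT Nk => s0; rewrite -leqNgt; apply: leq_trans sN.
    elim: s s0 {k0} => //= b s IHs; rewrite inE negb_or => /andP[b0 /IHs].
    case: b b0 => // b _; rewrite addSn ltnS.
    by move=> /leq_trans; apply; rewrite leq_addl.
  by rewrite (big_rem 0) //= mul0n.
rewrite /balanced; set q := N %/ _; set r := N %% _; set k := size s.
have q0 : 0 < q by rewrite divn_gt0.
have rk : r <= k by apply/ltnW/ltn_pmod.
have NE : N = q * k + r by apply: divn_eq.
(* The common factor by which prod_tangent exceeds the claim. *)
have pos : 0 < q ^ (q * k + r) * q.+1 ^ (q * k).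
  by rewrite muln_gt0 !expn_gt0 q0.
rewrite -(leq_pmul2r pos) mulnA.
rewrite [leqRHS](_ : _ = q ^ (q.+1 * k) * q.+1 ^ N); last first.
  have -> : q.+1 * k = k - r + (q * k + r).
    by rewrite addnCA subnK // mulSn addnC.
  by rewrite NE !expnD; ring.
rewrite -NE -(subnKC sN) (expnD q (sumn s)) (expnD q.+1 (sumn s)).
rewrite [leqLHS](_ : _ = \prod_(b <- s) b * q ^ sumn s * q.+1 ^ (q * k) *
  q ^ (N - sumn s)); last by ring.
rewrite [leqRHS]mulnA. apply: leq_mul (prod_tangent q s) _.
by case: (N - sumn s) => [|m] //; rewrite leq_exp2r ?leqnSn.
Qed.

Lemma balanced_attained N k :
  exists2 s : seq nat, size s = k /\ sumn s <= N &
    \prod_(b <- s) b = balanced N k.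
Proof.
case: k => [|k]; first by exists [::]; rewrite ?big_nil ?balanced0.
set r := N %% k.+1; set q := N %/ k.+1.
have rk : r <= k.+1 by apply/ltnW/ltn_pmod.
exists (nseq (k.+1 - r) q ++ nseq r q.+1); last first.
  by rewrite big_cat !big_nseq !iter_muln_1.
rewrite size_cat !size_nseq subnK // sumn_cat !sumn_nseq; split=> //.
by rewrite mulSn addnCA addnC -mulnDr subnK // -divn_eq.
Qed.

Lemma balanced_mono k : {homo balanced^~ k : N M / N <= M}.
Proof.
move=> N M NM; have [s [sk sN] <-] := balanced_attained N k.
by rewrite -sk; apply/prod_le_balanced/(leq_trans sN).
Qed.

(** The recursion matching the choice of a vertex with [d] non-neighbours. *)
Lemma balanced_step d N M k : d + N <= M -> d * balanced N k <= balanced M k.+1.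
Proof.
move=> dNM; have [s [sk sN] <-] := balanced_attained N k.
have H : sumn (d :: s) <= M by apply: leq_trans dNM; rewrite /= leq_add2l.
by have := prod_le_balanced H; rewrite big_cons /= sk.
Qed.

End Product.

(** * The upper bound for flag complexes *)

Section UpperBound.

Local Open Scope nat_scope.

Variables (F : fieldType) (n : nat) (G : sgraph n).
Implicit Types (u v w : 'I_n) (s W : {set 'I_n}).

Lemma adj_sym u v : adj G u v = adj G v u.
Proof. by rewrite /adj setUC. Qed.

Lemma adj_irrefl u : adj G u u = false.
Proof.
apply/negP => uu; move/forall_inP: (valP G) => /(_ _ uu).
by rewrite setUid cards1.
Qed.

Lemma cliqueP s :
  reflect {in s &, forall u v, u != v -> adj G u v} (s \in flag_complex G).
Proof.
rewrite inE; apply: (iffP forall_inP) => [H u v us vs|H u us].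
  by move: (forall_inP (H u us) v vs) => /implyP.
by apply/forall_inP => v vs; apply/implyP/H.
Qed.

Lemma clique_add w s :
  w \notin s ->
  (w |: s \in flag_complex G) =
  (s \in flag_complex G) && (s \subset [set u | adj G w u]).
Proof.
move=> ws; apply/cliqueP/andP => [H|[/cliqueP sG /subsetP sw] u v].
  split.
    by apply/cliqueP => u v us vs; apply: H; rewrite inE ?us ?vs orbT.
  apply/subsetP => u us; rewrite inE; apply: H; rewrite ?setU11 //.
    by rewrite inE us orbT.
  by apply: contraNneq ws => ->.
rewrite !in_setU1 => /predU1P[->|us] /predU1P[->|vs]; rewrite ?eqxx // => uv.
- by have := sw _ vs; rewrite inE.
- by have := sw _ us; rewrite inE adj_sym.
- exact: sG.
Qed.

Definition nbrs v : {set 'I_n} := [set u | adj G v u].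

(** The flag complex of the subgraph induced by [W]; keeping the ambient vertex
    set lets all subgraphs share one chain space. *)
Definition induced W : {set {set 'I_n}} :=
  [set s in flag_complex G | s \subset W].

Definition non_nbrs W v : {set 'I_n} := (W :\ v) :\: nbrs v.

Lemma inducedE W s :
  (s \in induced W) = (s \in flag_complex G) && (s \subset W).
Proof. by rewrite inE. Qed.

Lemma induced_del W w :
  [set s : {set 'I_n} in induced W | w \notin s] = induced (W :\ w).
Proof. by apply/setP => s; rewrite !inE subsetD1 andbA. Qed.

Lemma induced_link W w : w \in W ->
  [set s : {set 'I_n} | (w \notin s) && (w |: s \in induced W)]
    = induced (W :&: nbrs w).
Proof.
move=> wW; apply/setP => s; rewrite inE !inducedE subUset sub1set wW subsetI /=.
have [ws|ws] := boolP (w \in s); last first.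
  by rewrite clique_add // -andbA (andbC (s \subset W)).
apply/esym/negP => /and3P[_ _ /subsetP /(_ w ws)].
by rewrite inE adj_irrefl.
Qed.

Lemma reduced_betti_dominating W v p : v \in W -> non_nbrs W v = set0 ->
  reduced_betti F (induced W) p = 0.
Proof.
move=> vW nn; apply: (@reduced_betti_cone _ _ v) => s; rewrite !inducedE.
case/andP=> sG sW; have [vs|vs] := boolP (v \in s).
  by rewrite (setUidPr _) ?sub1set // sG.
rewrite clique_add // sG subUset sub1set vW sW /= andbT.
apply/subsetP => u us; rewrite inE; apply: contraT => uv.
have : u \in non_nbrs W v; last by rewrite nn inE.
by rewrite !inE uv (subsetP sW) // andbT; apply: contraNneq vs => <-.
Qed.

(** After the non-neighbours of [v] are removed, a cone remains.  The hypothesis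
    bounds the links met on the way, which live in subsets [W'] of [W]. *)
Lemma reduced_betti_delete_non_nbrs W v p m : v \in W ->
  (forall w W', W' \subset W -> w \in non_nbrs W v ->
     reduced_betti F (induced (W' :&: nbrs w)) p <= m) ->
  reduced_betti F (induced W) p.+1 <= #|non_nbrs W v| * m.
Proof.
move=> vW Hm; have [d] := ubnP #|non_nbrs W v|.
elim: d W vW Hm => // d IHd W vW Hm dW.
have [nn|[w wnn]] := set_0Vmem (non_nbrs W v).
  by rewrite (reduced_betti_dominating _ vW).
have /and3P[wv wW _] : [&& w != v, w \in W & w \notin nbrs v].
  by move: wnn; rewrite /non_nbrs !in_setD in_set1; case/and3P=> -> -> ->.
have dE : non_nbrs (W :\ w) v = non_nbrs W v :\ w.
  by apply/setP => u; rewrite !inE; do ![case: (_ == _) => //=]; rewrite ?andbF.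
have cE : #|non_nbrs W v| = #|non_nbrs (W :\ w) v|.+1.
  by rewrite dE (cardsD1 w (non_nbrs W v)) wnn.
apply: leq_trans (reduced_betti_del_link F w (induced W) p) _.
rewrite induced_del induced_link // cE mulSn addnC leq_add ?Hm //.
apply: IHd; first by rewrite !inE eq_sym wv.
- move=> u W' W'W unn; apply: Hm; first exact: subset_trans W'W (subsetDl _ _).
  by move: unn; rewrite dE inE => /andP[].
- by rewrite -ltnS -cE.
Qed.

Lemma card_nbrs W w : w \in W -> #|W| = (#|W :&: nbrs w| + #|non_nbrs W w|).+1.
Proof.
move=> wW; rewrite (cardsD1 w W) wW -(cardsID (nbrs w) (W :\ w)).
congr (#|pred_of_set _| + _).+1.
by apply/setP => u; rewrite !inE; case: eqP => //= ->; rewrite adj_irrefl andbF.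
Qed.

Theorem reduced_betti_le W p :
  reduced_betti F (induced W) p <= balanced (#|W| - p) p.
Proof.
elim: p W => [|p IHp] W.
  apply: leq_trans (reduced_betti_le_card _ _ _) _.
  rewrite balanced0 -(cards1 (set0 : {set 'I_n})).
  apply/subset_leq_card/subsetP => s.
  by rewrite !inE cards_eq0 => /andP[].
have [W0|[v0 v0W]] := set_0Vmem W.
  rewrite W0; apply: leq_trans (reduced_betti_le_card _ _ _) _.
  rewrite (_ : [set s in _ | _] = set0) ?cards0 //.
  apply/setP => s; rewrite !inE subset0.
  by case: eqP => [->|_]; rewrite ?andbF // cards0 andbF.
have [v vW vmin] := @arg_minnP _ v0 (mem W) (fun v => #|non_nbrs W v|) v0W.
have cW := card_nbrs vW.
pose m := balanced (#|W :&: nbrs v| - p) p.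
apply: leq_trans (reduced_betti_delete_non_nbrs (m := m) vW _) _.
  move=> w W' W'W wnn; apply: leq_trans (IHp _) _.
  have wW : w \in W by move: wnn; rewrite !inE => /and3P[].
  apply: balanced_mono; apply: leq_sub2r.
  apply: leq_trans (subset_leq_card (setSI _ W'W)) _.
  by move: (vmin w wW) (card_nbrs wW); rewrite cW; lia.
(* If v has fewer than p neighbours in W, then p > 0 and m = 0. *)
rewrite {}/m; have [pN|Np] := leqP p #|W :&: nbrs v|.
  by apply: balanced_step; lia.
rewrite (eqP (ltnW Np : _ - _ == 0)) /balanced div0n mod0n subn0.
by case: p Np {IHp} => // p _; rewrite exp0n // mul0n muln0.
Qed.

End UpperBound.

(** * Cross-polytopes in complete multipartite graphs *)

Section Cross.

Local Open Scope ring_scope.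

Variables (F : fieldType) (n : nat).

Notation chain := {ffun {set 'I_n} -> F^o}.

(** The fundamental cycle of the cross-polytope whose pairs of opposite vertices
    are listed in [l]: the exterior product of the differences [e.1 - e.2]. *)
Definition cross_cycle (l : seq ('I_n * 'I_n)) : chain :=
  foldr (fun e c => ext F e.1 c - ext F e.2 c) (simplex F set0) l.

Lemma boundary_cross_cycle l : boundary F n (cross_cycle l) = 0.
Proof.
elim: l => [|e l IHl] /=.
  by rewrite boundaryE /boundary_simplex big_set0.
by rewrite linearB /= !boundary_ext IHl !linear0 subrr.
Qed.

Lemma cross_cycle_cons e l (t : {set 'I_n}) : cross_cycle (e :: l) t =
  ext F e.1 (cross_cycle l) t - ext F e.2 (cross_cycle l) t.
Proof. by rewrite /= !ffunE. Qed.

(** Records, by means of colours that are constant on each pair, that a facet of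
    the cross-polytope takes a vertex from every pair. *)
Lemma cross_cycle_support (J : eqType) (col : 'I_n -> J) l (t : {set 'I_n}) :
  (forall e, e \in l -> col e.1 = col e.2) -> cross_cycle l t != 0 ->
  [/\ #|t| = size l, {subset t <= unzip1 l ++ unzip2 l} &
      {subset [seq col e.1 | e <- l] <= [seq col u | u <- enum t]}].
Proof.
elim: l t => [|e l IHl] t lc.
  rewrite ffunE; have [-> _|_] := eqVneq t set0; last by rewrite eqxx.
  by rewrite cards0; split=> // u; rewrite inE.
rewrite cross_cycle_cons !extE => nz.
have [v [ve vt tv]] : 
    exists v, [/\ v \in [:: e.1; e.2], v \in t & cross_cycle l (t :\ v) != 0].
  move: nz; case: ifP => e1t; last first.
    rewrite sub0r oppr_eq0; case: ifP => e2t; last by rewrite eqxx.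
    rewrite mulf_eq0 negb_or => /andP[_ nz].
    by exists e.2; rewrite !inE eqxx orbT.
  have [z1|nz _] := eqVneq (cross_cycle l (t :\ e.1)) 0.
    rewrite z1 mulr0 sub0r oppr_eq0; case: ifP => e2t; last by rewrite eqxx.
    rewrite mulf_eq0 negb_or => /andP[_ nz].
    by exists e.2; rewrite !inE eqxx orbT.
  by exists e.1; rewrite !inE eqxx.
have [|ct st colt] := IHl _ _ tv.
  by move=> f fl; rewrite lc ?inE ?fl ?orbT.
split; first by rewrite (cardsD1 v) vt ct.
  move=> u ut; rewrite mem_cat !inE; have [uv|uv] := eqVneq u v.
    by move: ve; rewrite -uv !inE => /orP[]->; rewrite ?orbT.
  have : u \in unzip1 l ++ unzip2 l by apply: st; rewrite !inE uv.
  by rewrite mem_cat => /orP[]->; rewrite ?orbT.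
move=> j; rewrite inE => /predU1P[->|/colt /mapP[u]].
  have -> : col e.1 = col v.
    by move: ve; rewrite !inE => /orP[]/eqP-> //; apply: lc; rewrite inE eqxx.
  by apply: map_f; rewrite mem_enum.
by rewrite mem_enum !inE => /andP[_ ut] ->; apply: map_f; rewrite mem_enum.
Qed.

(** The facet formed by all first vertices arises in a single way when the
    exterior product is expanded, so that nothing cancels. *)
Lemma cross_cycle_top l (t : {set 'I_n}) :
  uniq (unzip1 l) -> (forall e, e \in l -> e.2 \notin t) -> t =i unzip1 l ->
  cross_cycle l t != 0.
Proof.
elim: l t => [|e l IHl] t.
  move=> _ _ t0; rewrite ffunE (_ : t = set0) ?eqxx ?oner_neq0 //.
  by apply/setP => u; rewrite t0 !inE.
move=> /= /andP[el ul] bt tE.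
rewrite -/(cross_cycle (e :: l)) cross_cycle_cons !extE.
rewrite (negbTE (bt e _)) ?mem_head // subr0 tE mem_head mulf_eq0 signr_eq0 /=.
apply: IHl => // [f fl|u].
  by rewrite inE negb_and bt ?orbT // inE fl orbT.
rewrite !inE tE inE; case: eqP => //= ->; exact/esym/negbTE.
Qed.

(** The matrix of the coefficients [z i (T j)] is diagonal and invertible. *)
Lemma leq_dim_dual (I : finType) (A : {pred I}) (z : I -> chain)
    (T : I -> {set 'I_n}) (U : {vspace chain}) :
  {in A, forall i, z i \in U} -> {in A, forall i, z i (T i) != 0} ->
  {in A &, forall i j, z i (T j) != 0 -> i = j} -> (#|A| <= \dim U)%N.
Proof.
move=> zU zT zI; have : free (image_tuple z A).
  apply/freeP => k k0 i; have iA := enum_valP i.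
  have := congr1 (fun c : chain => c (T (enum_val i))) k0.
  rewrite sum_ffunE ffunE (bigD1 i) //= big1 => [|j ji]; last first.
    rewrite ffunE nth_image.
    have [->|nz] := eqVneq (z (enum_val j) (T (enum_val i))) 0.
      by rewrite scaler0.
    by case/eqP: ji; apply/enum_val_inj/zI => //; apply: enum_valP.
  rewrite addr0 ffunE nth_image => /eqP.
  rewrite scaler_eq0 (negbTE (zT _ iA)) orbF.
  by move/eqP.
rewrite /free size_tuple => /eqP <-.
apply/dimvS/span_subvP => _ /imageP[i iA ->].
exact: zU.
Qed.

End Cross.

Section Multipartite.

Local Open Scope ring_scope.

Variables (F : fieldType) (n p : nat) (G : sgraph n) (col : 'I_n -> 'I_p).
Hypothesis adjG : forall u v, adj G u v = (col u != col v).

Lemma clique_multipartite s : s \in flag_complex G -> {in s &, injective col}.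
Proof.
move=> /cliqueP sG u v us vs uv.
apply/eqP; apply: contraTT (eqxx (col u)) => nuv.
by rewrite {2}uv -adjG sG.
Qed.

Lemma reduced_betti_multipartite :
  (\prod_(i < p) (#|[set u | col u == i]| - 1)
     <= reduced_betti F (flag_complex G) p)%N.
Proof.
have top : chains F (flag_complex G) p.+1 = 0%VS.
  apply/eqP; rewrite -subv0; apply/subvP => c /chainsP cK.
  rewrite memv0; apply/eqP/ffunP => s.
  rewrite ffunE; apply/eqP/negPn/negP => /cK[/clique_multipartite cs sp].
  by have := leq_card_in _ _ cs; rewrite sp card_ord ltnn.
rewrite /reduced_betti top limg0 dimv0 subn0.
(* An empty part annihilates the product, by truncated subtraction. *)
have [/existsP[i /eqP i0]|/existsPn ne] :=
    boolP [exists i, [set u | col u == i] == set0].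
  by rewrite (bigD1 i) //= i0 cards0.
have base_ex i : exists u, col u == i.
  by case/set0Pn: (ne i) => u; rewrite inE => uA; exists u.
pose b i := xchoose (base_ex i).
have colb i : col (b i) = i by apply/eqP; exact: xchooseP (base_ex i).
pose A : pred {ffun 'I_p -> 'I_n} :=
  family (fun i => [pred u | (col u == i) && (u != b i)]).
have -> : (\prod_(i < p) (#|[set u | col u == i]| - 1) = #|A|)%N.
  rewrite card_family foldrE big_image /=; apply: eq_bigr => i _.
  rewrite (cardsD1 (b i)) inE colb eqxx add1n subn1 /=.
  by apply: eq_card => u; rewrite !inE andbC.
pose l (x : {ffun 'I_p -> 'I_n}) := [seq (x i, b i) | i <- enum 'I_p].
have AP x : x \in A -> forall i, col (x i) = i /\ x i != b i.
  by move=> /familyP xA i; have /andP[/eqP] := xA i.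
have lu x : unzip1 (l x) = [seq x i | i <- enum 'I_p].
  by rewrite /unzip1 -map_comp.
have lb x : unzip2 (l x) = [seq b i | i <- enum 'I_p].
  by rewrite /unzip2 -map_comp.
have lc x : x \in A -> forall e, e \in l x -> col e.1 = col e.2.
  by move=> /AP xA e /mapP[i _ ->] /=; rewrite colb; case: (xA i).
apply: (@leq_dim_dual F n _ A (fun x => cross_cycle F (l x))
  (fun x => x @: setT)) => [x xA|x xA|x y xA yA nz].
- rewrite memv_cap memv_ker boundary_cross_cycle eqxx andbT.
  apply/chainsP => t /(cross_cycle_support (lc x xA))[tp _ tc].
  have {}tp : #|t| = p by rewrite tp size_map -cardE card_ord.
  split=> //; apply/cliqueP => u v ut vt uv; rewrite adjG.
  apply: contraNneq uv => cuv.
  (* t has p vertices and meets all p colours, hence each of them once. *)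
  have /imset_injP inj : #|col @: t| == #|t|.
    rewrite eqn_leq leq_imset_card tp -[X in (X <= _)%N]card_ord.
    rewrite subset_leq_card //.
    apply/subsetP => i _; have /tc/mapP[w] : i \in [seq col e.1 | e <- l x].
      apply/mapP; exists (x i, b i); first by apply: map_f; rewrite mem_enum.
      by case: (AP x xA i).
    by rewrite mem_enum => wt ->; apply: imset_f.
  by apply/eqP/inj.
- apply: cross_cycle_top => [|_ /mapP[i _ ->] /=|u].
  + rewrite lu map_inj_uniq ?enum_uniq // => i j xij.
    by case: (AP x xA i) (AP x xA j) => <- _ [<- _]; rewrite xij.
  + apply/imsetP => -[j _ bij]; have [cj] := AP x xA j.
    by rewrite -bij -cj -bij colb eqxx.
  + rewrite lu; apply/imsetP/mapP => -[i _ ->]; exists i => //.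
    by rewrite mem_enum.
- have [_ sub _] := cross_cycle_support (lc x xA) nz.
  apply/ffunP => i; have [cy yb] := AP y yA i.
  have : y i \in unzip1 (l x) ++ unzip2 (l x) by apply/sub/imset_f.
  rewrite mem_cat lu lb => /orP[] /mapP[j _ yj].
    by move: cy; rewrite yj; case: (AP x xA j) => -> _ <-.
  have ji : j = i by rewrite -cy yj colb.
  by rewrite yj ji eqxx in yb.
Qed.

End Multipartite.

(** * The Turan graph *)

Section Turan.

Local Open Scope nat_scope.

Lemma prod_turan_sizes n p : 0 < p -> p <= n ->
  \prod_(i < p) (nth 0 (turan_sizes n p) i - 1) = balanced (n - p) p.
Proof.
move=> p0 pn; have rp : turan_rem n p <= p.
  by rewrite /turan_rem; case: ifP => // _; apply/ltnW/ltn_pmod.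
have -> : \prod_(i < p) (nth 0 (turan_sizes n p) i - 1) =
    (ceil_div n p - 1) ^ turan_rem n p * (n %/ p - 1) ^ (p - turan_rem n p).
  rewrite -(big_mkord xpredT (fun i => nth 0 (turan_sizes n p) i - 1)).
  have nthE i : i < p -> nth 0 (turan_sizes n p) i =
      if i < turan_rem n p then ceil_div n p else n %/ p.
    by move=> ip; rewrite (nth_map 0) ?size_iota // nth_iota.
  rewrite (big_cat_nat (leq0n _) rp) /=; congr (_ * _).
    rewrite -[in RHS](subn0 (turan_rem n p)) -prod_nat_const_nat.
    by apply: eq_big_nat => i ir; rewrite nthE ?ir // (leq_trans ir).
  rewrite -prod_nat_const_nat; apply: eq_big_nat => i /andP[ri ip].
  by rewrite nthE // ltnNge ri.
have q0 : 0 < n %/ p by rewrite divn_gt0.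
(* Taking one vertex away from each part lowers the quotient by one and keeps
   the remainder. *)
have nE : n = (n %/ p - 1) * p + n %% p + p.
  by rewrite addnAC -mulSnr subn1 prednK // -divn_eq.
have dE : (n - p) %/ p = n %/ p - 1.
  by rewrite {1}nE addnK divnMDl // [n %% p %/ p]divn_small ?ltn_pmod // addn0.
have mE : (n - p) %% p = n %% p by rewrite {1}nE addnK modnMDl modn_mod.
rewrite /balanced dE mE /turan_rem /ceil_div; case: ifP => [pdvd|/negbT npdvd].
  rewrite (eqP pdvd) subnn subn0 !expn0.
  by rewrite divnDl // [p.-1 %/ p]divn_small ?prednK // addn0.
have r0 : 0 < n %% p by rewrite lt0n.
rewrite mulnC; congr (_ * _ ^ _); rewrite (divn_eq n p) -addnA divnMDl //.
rewrite divnMDl // [n %% p %/ p]divn_small ?ltn_pmod // addn0.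
have -> : (n %% p + p.-1) %/ p = 1.
  rewrite -(prednK r0) addSnnS prednK // divnDr // divnn p0 divn_small //.
  by apply: leq_ltn_trans (leq_pred _) (ltn_pmod _ _).
by rewrite addnK subn1 prednK.
Qed.

Lemma balanced_dvd n p :
  0 < n -> p %| n -> balanced (n - p) p = (n %/ p - 1) ^ p.
Proof.
move=> n0 /dvdnP[[|m] nE]; first by rewrite nE in n0.
have p0 : 0 < p by case: p nE n0 => // ->; rewrite muln0.
by rewrite nE mulSn addKn -mulSn /balanced modnMl !mulnK // subn0 muln1 subn1.
Qed.

Lemma adj_turan n p (u v : 'I_n) :
  adj (turan n p) u v = (reshape_index (turan_sizes n p) u
                          != reshape_index (turan_sizes n p) v).
Proof.
rewrite /adj /turan /compl_graph /graph_of_edges /= !inE cards2.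
case: (eqVneq u v) => [->|uv]; first by rewrite eqxx.
rewrite /=; congr (~~ _); apply/forall_inP/eqP => [H|H x].
  by move: (H u (set21 _ _)) => /forall_inP /(_ v (set22 _ _)) /eqP.
rewrite !inE => /orP[]/eqP->; apply/forall_inP => y;
  by rewrite !inE => /orP[]/eqP->; rewrite ?H.
Qed.

Lemma card_reshape_fiber n sh i : sumn sh = n ->
  nth 0 sh i <= #|[set u : 'I_n | reshape_index sh u == i]|.
Proof.
move=> <-; pose f (c : 'I_(nth 0 sh i)) := Ordinal (flatten_indexP (ltn_ord c)).
have f_inj : injective f.
  by move=> c d [] /addnI /val_inj.
rewrite -[X in X <= _]card_ord -cardsT -(card_imset _ f_inj).
apply/subset_leq_card/subsetP => _ /imsetP[c _ ->].
by rewrite inE /= flatten_indexKl.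
Qed.

Lemma betti_turan_ge (F : fieldType) n k : 0 < n ->
  balanced (n - k.+1) k.+1 <= betti F (flag_complex (turan n k.+1)) k.
Proof.
move=> n0.
(* With fewer vertices than parts, the truncated bound is 0. *)
have [kn|nk] := leqP k.+1 n; last first.
  by rewrite (eqP (ltnW nk : _ - _ == 0)) /balanced div0n mod0n subn0 exp0n.
set sh := turan_sizes n k.+1.
have sumsh : sumn sh = n by rewrite sumn_turan_sizes.
have rP (u : 'I_n) : reshape_index sh u < k.+1.
  by rewrite -[X in _ < X](size_turan_sizes n k.+1) reshape_indexP // sumsh.
pose col u := Ordinal (rP u).
apply: leq_trans (@reduced_betti_multipartite F n _ (turan n k.+1) col _);
  last first.
  by move=> u v; rewrite adj_turan.
rewrite -prod_turan_sizes //; apply: leq_prod => i _; apply: leq_sub2r.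
exact: card_reshape_fiber.
Qed.

Lemma betti_le (F : fieldType) n (G : sgraph n) k :
  betti F (flag_complex G) k <= balanced (n - k.+1) k.+1.
Proof.
have := reduced_betti_le F G setT k.+1; rewrite cardsT card_ord.
rewrite (_ : induced G setT = flag_complex G) //.
by apply/setP => s; rewrite inE subsetT andbT.
Qed.

End Turan.

Theorem corollary11 (F : fieldType) (n k : nat) (hn : (1 <= n)%N) :
  (\max_(G : sgraph n) betti F (flag_complex G) k)%N
    = betti F (flag_complex (turan n k.+1)) k
  /\ ((k.+1 %| n)%N ->
      (\max_(G : sgraph n) betti F (flag_complex G) k)%N
        = ((n %/ k.+1 - 1) ^ k.+1)%N).
Proof.
have turanE : betti F (flag_complex (turan n k.+1)) k = balanced (n - k.+1) k.+1.
  by apply/eqP; rewrite eqn_leq betti_le betti_turan_ge.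
have maxE : (\max_(G : sgraph n) betti F (flag_complex G) k)%N
    = betti F (flag_complex (turan n k.+1)) k.
  apply/eqP; rewrite eqn_leq leq_bigmax andbT.
  by apply/bigmax_leqP => G _; rewrite turanE betti_le.
by split=> // kn; rewrite maxE turanE balanced_dvd.
Qed.
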